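(* Consider the product-type IMEX-RK projection scheme described in the context, with coefficients $(A,\boldsymbol b,D)$ and time step $\tau>0$. Let $B=\mathrm{diag}(b_1,\dots,b_s)$ and define the symmetric $s\times s$ matrices $$Q=BDA+(BDA)^\top-\boldsymbol b\boldsymbol b^\top,\qquad R=\boldsymbol b\boldsymbol b^\top-BJA-(BJA)^\top .$$ If $b_i\geqslant 0$ for all $i=1,\dots,s$ and $Q$ and $R$ are positive semi-definite, then the scheme preserves the unit length, $|\boldsymbol m^{n+1}|=1$, and the energy dissipation law $$\int_\Omega \tfrac12\big|\nabla\boldsymbol m^{n+1}\big|^2\,\mathrm d\boldsymbol x\leqslant\int_\Omega\tfrac12\big|\nabla\boldsymbol m^{n}\big|^2\,\mathrm d\boldsymbol x .$$
   Context: The continuous problem is the gradient flow of the Dirichlet energy $E[\boldsymbol m]=\int_\Omega\frac12|\nabla\boldsymbol m|^2\,\mathrm d\boldsymbol x$ for $\boldsymbol m:\Omega\to\mathbb R^3$ with unit length $|\boldsymbol m|=1$: $$\boldsymbol m_t=P(\boldsymbol m)\Delta\boldsymbol m,\qquad P(\boldsymbol m)\boldsymbol v=\alpha\Big(\boldsymbol v-\frac{(\boldsymbol m\cdot\boldsymbol v)\boldsymbol m}{|\boldsymbol m|^2}\Big)+\beta\,\boldsymbol m\times\boldsymbol v,$$ with constants $\alpha>0$, $\beta\in\mathbb R$, initial data of unit length, and either time-independent Dirichlet boundary conditions or homogeneous Neumann boundary conditions on $\partial\Omega$ ($\Omega$ a bounded domain with sufficiently regular boundary). Coefficients: $A=(a_{ij})$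 and $D=(d_{ij})$ are real lower triangular $s\times s$ matrices with $a_{ii}>0$, $d_{ii}>0$ and $\sum_{j=1}^i d_{ij}=1$ for $i=1,\dots,s$; $\boldsymbol b=(b_1,\dots,b_s)^\top\in\mathbb R^s$. $J$ is the $s\times s$ matrix with ones on the first subdiagonal and zeros elsewhere. Scheme (discrete in time, continuous in space): given $\boldsymbol m^n$ with $|\boldsymbol m^n|=1$, set $\boldsymbol u_0=\boldsymbol m^n$ and $$\boldsymbol u_i=\boldsymbol u_0+\tau\sum_{j=1}^i a_{ij}P(\boldsymbol u_{j-1})\sum_{k=1}^j d_{jk}\Delta\boldsymbol u_k,\quad i=1,\dots,s,$$ $$\tilde{\boldsymbol m}^{n+1}=\boldsymbol u_0+\tau\sum_{j=1}^s b_jP(\boldsymbol u_{j-1})\sum_{k=1}^j d_{jk}\Delta\boldsymbol u_k,\qquad \boldsymbol m^{n+1}=\frac{\tilde{\boldsymbol m}^{n+1}}{|\tilde{\boldsymbol m}^{n+1}|},$$ where every $\boldsymbol u_i$ satisfies the boundary conditions of the problem (the same Dirichlet data as $\boldsymbol m^n$, or homogeneous Neumann). The stages $\boldsymbol u_i$ are assumed to exist, to be such that the expressions $P(\boldsymbol u_{j-1})$ are well defined, and to be regular enough for integration by parts. *)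

(* Defs.v *)
From HB Require Import structures.
From mathcomp Require Import all_boot all_order all_algebra.
From mathcomp Require Import all_classical all_reals all_analysis.

Set Implicit Arguments.
Unset Strict Implicit.
Unset Printing Implicit Defensive.

Import Order.TTheory GRing.Theory Num.Theory.
Import numFieldNormedType.Exports.

Local Open Scope classical_set_scope.
Local Open Scope ring_scope.

(* The library norm on row vectors is the sup norm, so the Euclidean length
   used throughout is introduced here. *)
Definition dot (R : realType) (n : nat) (v w : 'rV[R]_n) : R :=
  \sum_i v 0 i * w 0 i.

Definition elen (R : realType) (n : nat) (v : 'rV[R]_n) : R :=
  Num.sqrt (dot v v).

(* Indices are added in 'I_3, i.e. modulo 3. *)
Definition cross (R : realType) (v w : 'rV[R]_3) : 'rV[R]_3 :=
  \row_k (v 0 (k + 1) * w 0 (k + 2) - v 0 (k + 2) * w 0 (k + 1)).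

Definition Pop (R : realType) (alpha beta : R) (m v : 'rV[R]_3) : 'rV[R]_3 :=
  alpha *: (v - (dot m v / elen m ^+ 2) *: m) + beta *: cross m v.

Definition psd (R : realType) (n : nat) (M : 'M[R]_n) : Prop :=
  forall x : 'cV[R]_n, 0 <= (x^T *m M *m x) 0 0.

Definition borel_rV (R : realType) (d : nat) :=
  g_sigma_algebraType (@open 'rV[R]_d).

(* This property characterizes the Lebesgue measure on the Borel sets of R^d. *)
Definition is_lebesgue (R : realType) (d : nat)
    (mu : {measure set (borel_rV R d) -> \bar R}) : Prop :=
  forall a b : 'rV[R]_d, (forall i, a 0 i <= b 0 i) ->
    mu [set x : 'rV[R]_d | forall i, a 0 i < x 0 i <= b 0 i]
    = (\prod_i (b 0 i - a 0 i))%:E.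

Section Fields.
Context {R : realType} {d : nat} {W : normedModType R}.
Implicit Types (Omega : set 'rV[R]_d) (f : 'rV[R]_d -> W).

Definition partial (i : 'I_d) f : 'rV[R]_d -> W :=
  fun x => 'D_(delta_mx 0 i : 'rV[R]_d) f x.

Definition laplacian f : 'rV[R]_d -> W :=
  fun x => \sum_i partial i (partial i f) x.

Definition C1 Omega f : Prop :=
  forall x, Omega x ->
    differentiable f x /\ forall i, {for x, continuous (partial i f)}.

Definition C2 Omega f : Prop :=
  C1 Omega f /\ forall i, C1 Omega (partial i f).

(* Existence of a continuous extension from Omega to its closure. *)
Definition C0bar Omega f : Prop :=
  exists2 g : 'rV[R]_d -> W,
    {within closure Omega, continuous g} & {in Omega, f =1 g}.

Definition C1bar Omega f : Prop :=
  [/\ C1 Omega f, C0bar Omega f & forall i, C0bar Omega (partial i f)].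

(* Boundary value: for f in C0bar, the value at a point of the closure of the
   continuous extension of the restriction of f to Omega. *)
Definition trace Omega f (x : 'rV[R]_d) : W :=
  lim (f y @[y --> within Omega (nbhs x)]).

Definition bdry Omega : set 'rV[R]_d := closure Omega `\` Omega°.

Definition normal_derivative Omega (nu : 'rV[R]_d -> 'rV[R]_d) f
    (x : 'rV[R]_d) : W :=
  \sum_i nu x 0 i *: trace Omega (partial i f) x.

End Fields.

Definition divergence (R : realType) (d : nat) (F : 'I_d -> 'rV[R]_d -> R)
    (x : 'rV[R]_d) : R :=
  \sum_i partial i (F i) x.

(* A bounded domain whose boundary is regular enough for the divergence
   theorem, for fields in C^1(Omega) and continuous up to the boundary with
   integrable divergence.  The identity determines the vector measure
   nu * sigma on the boundary, so nu is necessarily the outward unit normal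
   and sigma the surface measure; bounded Lipschitz domains qualify. *)
Record regular_domain (R : realType) (d : nat)
    (mu sigma : {measure set (borel_rV R d) -> \bar R})
    (Omega : set 'rV[R]_d) (nu : 'rV[R]_d -> 'rV[R]_d) : Prop := {
  domain_open : open Omega;
  domain_nonempty : Omega !=set0;
  domain_connected : connected Omega;
  domain_bounded : bounded_set Omega;
  surface_finite : (sigma (bdry Omega) < +oo)%E;
  normal_measurable : forall i,
    measurable_fun (bdry Omega : set (borel_rV R d)) (fun x => nu x 0 i);
  normal_unit : {ae sigma, forall x, bdry Omega x -> elen (nu x) = 1};
  divergence_theorem : forall F : 'I_d -> 'rV[R]_d -> R,
    (forall i, C1 Omega (F i) /\ C0bar Omega (F i)) ->
    mu.-integrable Omega (fun x => (divergence F x)%:E) ->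
    (\int[mu]_(x in Omega) (divergence F x)%:E
     = \int[sigma]_(x in bdry Omega)
         (\sum_i trace Omega (F i) x * nu x 0 i)%:E)%E
}.

Definition energy (R : realType) (d : nat)
    (mu : {measure set (borel_rV R d) -> \bar R}) (Omega : set 'rV[R]_d)
    (m : 'rV[R]_d -> 'rV[R]_3) : \bar R :=
  (\int[mu]_(x in Omega)
     (2^-1 * \sum_i elen (partial i m x) ^+ 2)%:E)%E.

Section Scheme.
Context {R : realType} {d s : nat}.
Variables (alpha beta tau : R) (A D : 'M[R]_s) (b : 'cV[R]_s).
Variable u : nat -> 'rV[R]_d -> 'rV[R]_3.

(* Row and column indices run over 0..s-1 while stages are numbered 0..s, so
   the paper's a_ij, d_ij, b_j have their indices shifted by one here, and
   slope j stands for  P(u_j) sum_(k <= j+1) d_(j+1,k) Delta u_k. *)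
Definition slope (j : 'I_s) (x : 'rV[R]_d) : 'rV[R]_3 :=
  Pop alpha beta (u j x)
    (\sum_(k < s | (k <= j)%N) D j k *: laplacian (u k.+1) x).

Definition stage_equations (Omega : set 'rV[R]_d) : Prop :=
  forall (i : 'I_s) x, Omega x ->
    u i.+1 x = u 0%N x + tau *: \sum_(j < s | (j <= i)%N) A i j *: slope j x.

Definition mtilde (x : 'rV[R]_d) : 'rV[R]_3 :=
  u 0%N x + tau *: \sum_(j < s) b j 0 *: slope j x.

Definition mnext (x : 'rV[R]_d) : 'rV[R]_3 :=
  (elen (mtilde x))^-1 *: mtilde x.

End Scheme.

Definition dirichlet (R : realType) (d s : nat) (Omega : set 'rV[R]_d)
    (u : nat -> 'rV[R]_d -> 'rV[R]_3) : Prop :=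
  forall i, (1 <= i <= s)%N -> forall x, bdry Omega x ->
    trace Omega (u i) x = trace Omega (u 0%N) x.

Definition neumann (R : realType) (d s : nat)
    (sigma : {measure set (borel_rV R d) -> \bar R})
    (Omega : set 'rV[R]_d) (nu : 'rV[R]_d -> 'rV[R]_d)
    (u : nat -> 'rV[R]_d -> 'rV[R]_3) : Prop :=
  forall i, (1 <= i <= s)%N ->
    {ae sigma, forall x, bdry Omega x ->
       normal_derivative Omega nu (u i) x = 0}.

Record regular_stages (R : realType) (d s : nat)
    (mu : {measure set (borel_rV R d) -> \bar R}) (Omega : set 'rV[R]_d)
    (u : nat -> 'rV[R]_d -> 'rV[R]_3) : Prop := {
  initial_regular : C1bar Omega (u 0%N);
  stage_C2 : forall i, (1 <= i <= s)%N -> C2 Omega (u i);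
  stage_C1bar : forall i, (1 <= i <= s)%N -> C1bar Omega (u i);
  stage_laplacian : forall i, (1 <= i <= s)%N -> forall c : 'I_3,
    mu.-integrable Omega (fun x => (laplacian (u i) x 0 c)%:E)
}.

Definition subdiag (R : realType) (s : nat) : 'M[R]_s :=
  \matrix_(i, j) (i == j.+1 :> nat)%:R.

Definition Qmat (R : realType) (s : nat) (A D : 'M[R]_s) (b : 'cV[R]_s)
    : 'M[R]_s :=
  let B := diag_mx b^T in
  B *m D *m A + (B *m D *m A)^T - b *m b^T.

Definition Rmat (R : realType) (s : nat) (A : 'M[R]_s) (b : 'cV[R]_s)
    : 'M[R]_s :=
  let B := diag_mx b^T in
  let J := subdiag R s in
  b *m b^T - B *m J *m A - (B *m J *m A)^T.

(* Main.v *)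
Require Import Defs.
From HB Require Import structures.
From mathcomp Require Import all_boot all_order all_algebra.
From mathcomp Require Import ring lra.
From mathcomp Require Import all_classical all_reals all_analysis.
From mathcomp Require Import measurable_realfun.

Set Implicit Arguments.
Unset Strict Implicit.
Unset Printing Implicit Defensive.

Import Order.TTheory GRing.Theory Num.Theory.
Import numFieldNormedType.Exports.

Local Open Scope classical_set_scope.
Local Open Scope ring_scope.

(** Since [A] is invertible, the slopes are linear combinations [K_j] of the
    stages, so they are C^1 up to the boundary.  The update is
    [M = u_0 + tau sum_j b_j K_j], and expanding a square around the stages
    [u_(j-1) = u_0 + tau (J A K)_j] or the averages
    [v_j = u_0 + tau (D A K)_j] gives
      [|M|^2 = |u_0|^2 + 2 tau sum_j b_j (u_(j-1) . K_j) + tau^2 <R K, K>] and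
      [|DM|^2 = |Du_0|^2 + 2 tau sum_j b_j (Dv_j . DK_j) - tau^2 <Q DK, DK>].
    In the first, [u_(j-1) . K_j = 0], so [|M| >= 1], and then normalizing does
    not increase the gradient.  In the second, integrating by parts turns
    [Dv_j . DK_j] into [- Delta v_j . P(u_(j-1)) Delta v_j <= 0]; the boundary
    term vanishes because [K_j = 0] (Dirichlet) or [d v_j / d nu = 0]
    (Neumann) there. *)

(** * Coefficient algebra *)

Section Dot.
Context {R : realType} {n : nat}.
Implicit Types (a : R) (v w x : 'rV[R]_n).

Lemma dotC v w : dot v w = dot w v.
Proof. by apply: eq_bigr => i _; rewrite mulrC. Qed.

Lemma dotDr v w x : dot v (w + x) = dot v w + dot v x.
Proof. by rewrite -big_split; apply: eq_bigr => i _; rewrite !mxE mulrDr. Qed.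

Lemma dotZr a v w : dot v (a *: w) = a * dot v w.
Proof. by rewrite mulr_sumr; apply: eq_bigr => i _; rewrite !mxE mulrCA. Qed.

Lemma dotBr v w x : dot v (w - x) = dot v w - dot v x.
Proof. by rewrite dotDr -scaleN1r dotZr mulN1r. Qed.

Lemma dotE2 v : dot v v = \sum_i v 0 i ^+ 2.
Proof. by apply: eq_bigr => i _; rewrite expr2. Qed.

Lemma dot_ge0 v : 0 <= dot v v.
Proof. by rewrite dotE2; apply: sumr_ge0 => i _; exact: sqr_ge0. Qed.

Lemma sqr_elen v : elen v ^+ 2 = dot v v.
Proof. by rewrite sqr_sqrtr// dot_ge0. Qed.

Lemma sqr_elenE v : elen v ^+ 2 = \sum_i v 0 i ^+ 2.
Proof. by rewrite sqr_elen dotE2. Qed.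

Lemma dot_gt0 v : v != 0 -> 0 < dot v v.
Proof.
move=> v0; rewrite lt_def dot_ge0 andbT; apply: contra v0.
rewrite dotE2 psumr_eq0 => [/allP v0|i _]; last exact: sqr_ge0.
apply/eqP/rowP => i; rewrite mxE; apply/eqP.
by have := v0 i; rewrite mem_index_enum sqrf_eq0 => /(_ isT).
Qed.

(** Pairing [w] with its component orthogonal to [v] gives the squared length of that component. *)
Lemma dot_proj_ge0 v w : v != 0 ->
  0 <= dot w (w - (dot v w / dot v v) *: v).
Proof.
move=> /dot_gt0 v0; set a := _ / _.
suff -> : dot w (w - a *: v) = dot (w - a *: v) (w - a *: v) by exact: dot_ge0.
have av : dot v (w - a *: v) = 0.
  by rewrite dotBr dotZr divfK ?subrr// gt_eqF.
by rewrite [RHS]dotBr dotZr [dot _ v]dotC av mulr0 subr0 dotC.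
Qed.

End Dot.

(** * Orthogonality and positivity of [P(m)] *)

Section Projection.
Context {R : realType}.
Implicit Types (v w : 'rV[R]_3) (al be : R).

Lemma cross_dotl v w : dot v (cross v w) = 0.
Proof.
(* Unfolding the sum produces lifts of [ord0], while [cross] adds indices modulo 3; these equations
   bring both to the form 0, 1, 2. *)
have e1 : (lift ord0 ord0 : 'I_3) = 1 by exact/val_inj.
have e2 : (lift ord0 (lift ord0 ord0) : 'I_3) = 2 by exact/val_inj.
have e11 : 1 + 1 = 2 :> 'I_3 by exact/val_inj.
have e12 : 1 + 2 = 0 :> 'I_3 by exact/val_inj.
have e21 : 2 + 1 = 0 :> 'I_3 by exact/val_inj.
have e22 : 2 + 2 = 1 :> 'I_3 by exact/val_inj.
rewrite /dot !big_ord_recl big_ord0 !mxE e1 e2 !add0r e11 e12 e21 e22.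
ring.
Qed.

Lemma cross_dotr v w : dot w (cross v w) = 0.
Proof.
have -> : cross v w = -1 *: cross w v.
  by apply/rowP => i; rewrite !mxE; ring.
by rewrite dotZr cross_dotl mulr0.
Qed.

Lemma dot_Pop_eq0 al be v w : v != 0 -> dot v (Pop al be v w) = 0.
Proof.
move=> v0; rewrite /Pop dotDr !dotZr cross_dotl dotBr dotZr sqr_elen.
by rewrite divfK ?subrr ?mulr0 ?addr0// gt_eqF// dot_gt0.
Qed.

(** The gyroscopic part [be *: cross v w] is orthogonal to [w] whatever the sign of [be]; only the
    damping part contributes, and it is a projection. *)
Lemma dot_Pop_ge0 al be v w : 0 <= al -> v != 0 -> 0 <= dot w (Pop al be v w).
Proof.
move=> al0 v0; rewrite /Pop dotDr !dotZr cross_dotr mulr0 addr0 sqr_elen.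
by rewrite mulr_ge0// dot_proj_ge0.
Qed.

End Projection.

(** * Expansion of the squared update, and triangular matrices *)

Section Stages.
Context {R : realType} {s : nat}.
Implicit Types (A D X : 'M[R]_s) (b k : 'cV[R]_s) (z tau : R).

(* With [X = D] the matrix is [Q]; with [X = J] it is [- R]. *)
Lemma sqr_update X A b k z tau :
  (z + tau * \sum_j b j 0 * k j 0) ^+ 2 =
  z ^+ 2 + 2 * tau * (\sum_j b j 0 * (z + tau * (X *m A *m k) j 0) * k j 0)
  - tau ^+ 2 * (k^T *m (diag_mx b^T *m X *m A + (diag_mx b^T *m X *m A)^T
                        - b *m b^T) *m k) 0 0.
Proof.
set S := \sum_j b j 0 * k j 0.
set T := \sum_j b j 0 * (X *m A *m k) j 0 * k j 0.
have -> : \sum_j b j 0 * (z + tau * (X *m A *m k) j 0) * k j 0 =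
    z * S + tau * T.
  rewrite !mulr_sumr -big_split; apply: eq_bigr => j _ /=; ring.
have bk : (b^T *m k) 0 0 = S by rewrite mxE; apply: eq_bigr => j _; rewrite mxE.
have TE : (k^T *m (diag_mx b^T *m X *m A) *m k) 0 0 = T.
  rewrite -!mulmxA mul_diag_mx mxE; apply: eq_bigr => j _.
  by rewrite [k^T _ _]mxE [X in _ * X = _]mxE [b^T _ _]mxE !mulmxA; ring.
(* A 1 x 1 matrix equals its transpose, so a matrix and its transpose have the same quadratic
   form. *)
have TtrE : (k^T *m (diag_mx b^T *m X *m A)^T *m k) 0 0 = T.
  have -> M : k^T *m M^T *m k = (k^T *m (M *m k))^T.
    by rewrite !trmx_mul trmxK.
  by rewrite mxE mulmxA TE.
have -> : k^T *m (diag_mx b^T *m X *m A + (diag_mx b^T *m X *m A)^T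
                        - b *m b^T) *m k =
  k^T *m (diag_mx b^T *m X *m A) *m k + k^T *m (diag_mx b^T *m X *m A)^T *m k
  - (b^T *m k)^T *m (b^T *m k).
  rewrite mulmxBr mulmxDr mulmxBl mulmxDl.
  by rewrite [(b^T *m k)^T]trmx_mul trmxK !mulmxA.
have SE : ((b^T *m k)^T *m (b^T *m k)) 0 0 = S ^+ 2.
  by rewrite mxE big_ord1 [_^T _ _]mxE bk expr2.
have -> : forall M N P : 'M[R]_1, (M + N - P) 0 0 = M 0 0 + N 0 0 - P 0 0.
  by move=> M N P; rewrite !mxE.
rewrite TE TtrE SE; ring.
Qed.

Lemma energy_update_le A D b k z tau : psd (Qmat A D b) ->
  (z + tau * \sum_j b j 0 * k j 0) ^+ 2 <=
  z ^+ 2 + 2 * tau * (\sum_j b j 0 * (z + tau * (D *m A *m k) j 0) * k j 0).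
Proof.
by move=> Qpsd; rewrite (sqr_update D A) gerBl mulr_ge0 ?sqr_ge0//; exact: Qpsd.
Qed.

(** For [X = J] the quadratic term of the expansion is [+ tau^2 <R k, k>], so dropping it now bounds
    the square from below. *)
Lemma length_update_ge A b k z tau : psd (Rmat A b) ->
  z ^+ 2 + 2 * tau *
    (\sum_j b j 0 * (z + tau * (subdiag R s *m A *m k) j 0) * k j 0)
  <= (z + tau * \sum_j b j 0 * k j 0) ^+ 2.
Proof.
move=> /(_ k) Rpsd; rewrite (sqr_update (subdiag R s) A) lerDl -mulrN.
rewrite mulr_ge0 ?sqr_ge0//; apply: le_trans Rpsd _.
suff -> : Rmat A b = - (diag_mx b^T *m subdiag R s *m A +
    (diag_mx b^T *m subdiag R s *m A)^T - b *m b^T).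
  by rewrite mulmxN mulNmx mxE.
by rewrite /Rmat /= !opprD opprK [RHS]addrC addrA.
Qed.

Lemma trig_sum_mul A (y : 'cV[R]_s) (i : 'I_s) : is_trig_mx A ->
  \sum_(j < s | (j <= i)%N) A i j * y j 0 = (A *m y) i 0.
Proof.
move=> /is_trig_mxP Atrig; rewrite mxE.
rewrite [RHS](bigID (fun j : 'I_s => j <= i)%N)/=.
rewrite [X in _ + X]big1 ?addr0// => j.
by rewrite -ltnNge => /Atrig ->; rewrite mul0r.
Qed.

Lemma trig_unitmx A : is_trig_mx A -> (forall i, 0 < A i i) -> A \in unitmx.
Proof.
move=> Atrig Adiag; rewrite unitmxE det_trig// unitfE.
by apply/prodf_neq0 => i _; rewrite gt_eqF.
Qed.

Lemma mul_subdiag (y : 'cV[R]_s) (i : 'I_s) :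
  (subdiag R s *m y) i 0 = \sum_(j < s | i == j.+1 :> nat) y j 0.
Proof.
rewrite mxE [RHS]big_mkcond; apply: eq_bigr => j _; rewrite mxE.
by case: eqP => _; rewrite ?mul1r ?mul0r.
Qed.

End Stages.

(** * C^1 calculus, traces and measurability *)

(** The first-order expansion of [f] at [x] involves only values near [x], so it is also one of [g];
    uniqueness of the differential identifies its linear part. *)
Lemma near_eq_differentiable {R : numFieldType} {V W : normedModType R}
    (f g : V -> W) (x : V) :
  (\near x, f x = g x) -> differentiable f x -> differentiable g x.
Proof.
move=> fg /diff_locallyP[dc df].
have gdf : g \o shift x = cst (g x) + 'd f x +o_ 0 id.
  apply/eqaddoP => e e0; move/eqaddoP : df => /(_ e e0).
  have : \forall h \near 0, f (h + x) = g (h + x).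
    by move: fg; rewrite (near_shift 0) subr0.
  apply: filterS2 => h fgh; rewrite !fctE/= fgh.
  by rewrite (nbhs_singleton fg).
by apply/diff_locallyP; rewrite (diff_unique dc gdf).
Qed.

Section C1_theory.
Context {R : realType} {d : nat} (Omega : set 'rV[R]_d).
Implicit Types (f g : 'rV[R]_d -> R) (x : 'rV[R]_d).

Lemma partialD i f g x : differentiable f x -> differentiable g x ->
  partial i (fun y => f y + g y) x = partial i f x + partial i g x.
Proof.
by move=> df dg; exact: deriveD (diff_derivable _) (diff_derivable _).
Qed.

Lemma partialM i f g x : differentiable f x -> differentiable g x ->
  partial i (fun y => f y * g y) x = f x * partial i g x + g x * partial i f x.
Proof.
by move=> df dg; exact: deriveM (diff_derivable _) (diff_derivable _).
Qed.

Lemma partialZ i a f x : differentiable f x ->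
  partial i (fun y => a * f y) x = a * partial i f x.
Proof. by move=> df; exact: deriveZ (diff_derivable _). Qed.

Lemma differentiable_fsum {n} (f : 'I_n -> 'rV[R]_d -> R) x :
  (forall j, differentiable (f j) x) ->
  differentiable (fun y => \sum_j f j y) x.
Proof.
move=> df; rewrite (_ : (fun _ => _) = \sum_j f j); last first.
  by apply/funext => y; rewrite fct_sumE.
exact: differentiable_sum.
Qed.

Lemma partial_sum i {n} (f : 'I_n -> 'rV[R]_d -> R) x :
  (forall j, differentiable (f j) x) ->
  partial i (fun y => \sum_j f j y) x = \sum_j partial i (f j) x.
Proof.
move=> df; rewrite (_ : (fun _ => _) = \sum_j f j); last first.
  by apply/funext => y; rewrite fct_sumE.
by apply: derive_sum => j; exact: diff_derivable.
Qed.

Lemma partial_coord {n} i (f : 'rV[R]_d -> 'rV[R]_n) c x :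
  differentiable f x -> partial i (fun y => f y 0 c) x = partial i f x 0 c.
Proof.
by move=> df; rewrite /partial (derive_mx (diff_derivable _))// mxE.
Qed.

Lemma differentiable_coord_comp {n} (f : 'rV[R]_d -> 'rV[R]_n) c x :
  differentiable f x -> differentiable (fun y => f y 0 c) x.
Proof.
move=> df; apply: (@differentiable_comp _ _ _ _ f (fun v => v 0 c)) => //.
exact: differentiable_coord.
Qed.

Hypothesis Omega_open : open Omega.

Lemma near_domain {T} (f g : 'rV[R]_d -> T) x : Omega x ->
  (forall y, Omega y -> f y = g y) -> \near x, f x = g x.
Proof.
move=> Ox fg; have : \near x, Omega x by exact: open_nbhs_nbhs.
exact: filterS.
Qed.

Lemma continuous_at_eq {T : topologicalType} (f g : 'rV[R]_d -> T) x :
  Omega x -> (forall y, Omega y -> f y = g y) ->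
  {for x, continuous f} -> {for x, continuous g}.
Proof.
move=> Ox fg; rewrite /prop_for /continuous_at -(fg x Ox) => cf.
apply: cvg_trans cf; apply: (near_eq_cvg (F := nbhs x)).
by apply: near_domain => // y /fg.
Qed.

Lemma partial_eq {W : normedModType R} (f g : 'rV[R]_d -> W) i x :
  (forall y, Omega y -> f y = g y) -> Omega x -> partial i f x = partial i g x.
Proof. by move=> fg Ox; apply: near_eq_derive; exact: near_domain. Qed.

(** As [Omega] is open, equality on it is equality near each of its points. This allows a field to
    be replaced by a formula valid only inside [Omega]. *)
Lemma C1_eq f g : (forall y, Omega y -> f y = g y) -> C1 Omega f -> C1 Omega g.
Proof.
move=> fg C1f x Ox; have [df cdf] := C1f x Ox.
split=> [|i]; first exact: near_eq_differentiable (near_domain _ _) df.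
apply: continuous_at_eq (cdf i) => // y Oy.
exact: partial_eq.
Qed.

Lemma C1_differentiable {W : normedModType R} (f : 'rV[R]_d -> W) x :
  C1 Omega f -> Omega x -> differentiable f x.
Proof. by move=> C1f /C1f[]. Qed.

Lemma C1_continuous {W : normedModType R} (f : 'rV[R]_d -> W) x :
  C1 Omega f -> Omega x -> {for x, continuous f}.
Proof. by move=> C1f /C1f[/differentiable_continuous]. Qed.

Lemma C1D f g : C1 Omega f -> C1 Omega g -> C1 Omega (fun y => f y + g y).
Proof.
move=> C1f C1g x Ox; have [df cdf] := C1f x Ox; have [dg cdg] := C1g x Ox.
split=> [|i]; first exact: differentiableD.
apply: (@continuous_at_eq _ (fun y => partial i f y + partial i g y)) => //.
  by move=> y Oy; rewrite partialD//; exact: C1_differentiable Oy.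
exact: continuousD.
Qed.

Lemma C1M f g : C1 Omega f -> C1 Omega g -> C1 Omega (fun y => f y * g y).
Proof.
move=> C1f C1g x Ox; have [df cdf] := C1f x Ox; have [dg cdg] := C1g x Ox.
split=> [|i]; first exact: differentiableM.
apply: (@continuous_at_eq _
    (fun y => f y * partial i g y + g y * partial i f y)) => //.
  by move=> y Oy; rewrite partialM//; exact: C1_differentiable Oy.
have cf := C1_continuous C1f Ox; have cg := C1_continuous C1g Ox.
exact: continuousD (continuousM cf (cdg i)) (continuousM cg (cdf i)).
Qed.

Lemma C1_cst (a : R) : C1 Omega (cst a).
Proof.
move=> x _; split=> [|i]; first exact: differentiable_cst.
rewrite (_ : partial i (cst a) = cst 0); first exact: cst_continuous.
by apply/funext => y; exact: derive_cst.
Qed.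

Lemma C1_coord {n} (f : 'rV[R]_d -> 'rV[R]_n) c :
  C1 Omega f -> C1 Omega (fun y => f y 0 c).
Proof.
move=> C1f x Ox; have [df cdf] := C1f x Ox.
split=> [|i]; first exact: differentiable_coord_comp.
apply: (@continuous_at_eq _ (fun y => partial i f y 0 c)) => //.
  by move=> y Oy; rewrite partial_coord//; exact: C1_differentiable Oy.
apply: (@continuous_comp _ _ _ (partial i f) (fun v => v 0 c)) => //.
exact: coord_continuous.
Qed.

End C1_theory.

(** * Continuous extensions and boundary traces *)

Section Trace.
Context {R : realType} {d : nat} (Omega : set 'rV[R]_d).
Implicit Types (x : 'rV[R]_d).

(** At a point of the closure the filter of neighbourhoods restricted to [Omega] is proper, so the
    limit is unique. *)
Lemma trace_lim {W : normedModType R} (f : 'rV[R]_d -> W) x l :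
  closure Omega x -> f y @[y --> within Omega (nbhs x)] --> l ->
  trace Omega f x = l.
Proof.
move=> cx fl; have PF := within_nbhs_proper (cx : infer _).
by apply: cvg_lim fl; exact: norm_hausdorff.
Qed.

Lemma trace_eq {W : normedModType R} (f g : 'rV[R]_d -> W) x :
  (forall y, Omega y -> f y = g y) -> trace Omega f x = trace Omega g x.
Proof.
move=> fg; rewrite /trace; congr lim.
have fg' : {in Omega, f =1 g} by move=> y; rewrite inE => /fg.
rewrite eqEsubset; split; apply: (fmap_within_eq (F := nbhs x)) => //.
by move=> y /fg'.
Qed.

Lemma extension_cvg {W : normedModType R} (f g : 'rV[R]_d -> W) x :
  {within closure Omega, continuous g} -> {in Omega, f =1 g} ->
  closure Omega x -> f y @[y --> within Omega (nbhs x)] --> g x.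
Proof.
move=> /subspace_continuousP cg fg cx.
apply: (cvg_trans (fmap_within_eq (nbhs_filter x) fg)).
apply: cvg_trans (cg x cx); apply: cvg_fmap2.
by apply: within_subset; exact: subset_closure.
Qed.

Lemma C0bar_cvg {W : normedModType R} (f : 'rV[R]_d -> W) x :
  C0bar Omega f -> closure Omega x ->
  f y @[y --> within Omega (nbhs x)] --> trace Omega f x.
Proof.
move=> [g cg fg] cx; have fgx := extension_cvg cg fg cx.
by rewrite (trace_lim cx fgx).
Qed.

Lemma trace_continuous {W : normedModType R} (f : 'rV[R]_d -> W) :
  C0bar Omega f -> {within closure Omega, continuous (trace Omega f)}.
Proof.
move=> [g cg fg]; apply: subspace_eq_continuous (cg) => x.
by rewrite inE => cx; apply/esym/(trace_lim cx)/extension_cvg.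
Qed.

Lemma trace_id {W : normedModType R} (f : 'rV[R]_d -> W) x :
  C0bar Omega f -> Omega x -> trace Omega f x = f x.
Proof.
move=> [g cg fg] Ox; have cx := @subset_closure _ Omega x Ox.
by rewrite fg ?inE//; apply/(trace_lim cx)/extension_cvg.
Qed.

Lemma C0bar_eq {W : normedModType R} (f g : 'rV[R]_d -> W) :
  (forall y, Omega y -> f y = g y) -> C0bar Omega f -> C0bar Omega g.
Proof.
by move=> fg [h ch fh]; exists h => // x xO; rewrite -fh// fg// -inE.
Qed.

Implicit Types (f g : 'rV[R]_d -> R).

Lemma C0barD f g :
  C0bar Omega f -> C0bar Omega g -> C0bar Omega (fun y => f y + g y).
Proof.
move=> [f' cf ff'] [g' cg gg']; exists (fun y => f' y + g' y).
  by move=> x; exact: (cvgD (cf x) (cg x)).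
by move=> x Ox; rewrite ff'// gg'.
Qed.

Lemma C0barM f g :
  C0bar Omega f -> C0bar Omega g -> C0bar Omega (fun y => f y * g y).
Proof.
move=> [f' cf ff'] [g' cg gg']; exists (fun y => f' y * g' y).
  by move=> x; exact: (cvgM (cf x) (cg x)).
by move=> x Ox; rewrite ff'// gg'.
Qed.

Lemma C0bar_cst (a : R) : C0bar Omega (cst a).
Proof. by exists (cst a) => //; move=> x; exact: cvg_cst. Qed.

Lemma C0bar_coord {n} (f : 'rV[R]_d -> 'rV[R]_n) c :
  C0bar Omega f -> C0bar Omega (fun y => f y 0 c).
Proof.
move=> [g cg fg]; exists (fun y => g y 0 c); last by move=> x /fg ->.
move=> x; apply: (@cvg_comp _ _ _ g (fun v => v 0 c)); first exact: cg.
exact: coord_continuous.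
Qed.

Lemma traceD f g x : C0bar Omega f -> C0bar Omega g -> closure Omega x ->
  trace Omega (fun y => f y + g y) x = trace Omega f x + trace Omega g x.
Proof.
move=> C0f C0g cx; apply: trace_lim => //.
exact: cvgD (C0bar_cvg C0f cx) (C0bar_cvg C0g cx).
Qed.

Lemma traceM f g x : C0bar Omega f -> C0bar Omega g -> closure Omega x ->
  trace Omega (fun y => f y * g y) x = trace Omega f x * trace Omega g x.
Proof.
move=> C0f C0g cx; apply: trace_lim => //.
exact: cvgM (C0bar_cvg C0f cx) (C0bar_cvg C0g cx).
Qed.

Lemma trace_cst (a : R) x : closure Omega x -> trace Omega (cst a) x = a.
Proof. by move=> cx; apply: trace_lim => //; exact: cvg_cst. Qed.

Lemma trace_coord {n} (f : 'rV[R]_d -> 'rV[R]_n) c x :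
  C0bar Omega f -> closure Omega x ->
  trace Omega (fun y => f y 0 c) x = trace Omega f x 0 c.
Proof.
move=> C0f cx; apply: trace_lim => //.
apply: (@cvg_comp _ _ _ f (fun v => v 0 c)); first exact: C0bar_cvg C0f cx.
exact: coord_continuous.
Qed.

End Trace.

(** * Finite linear combinations of fields *)

Section Combination.
Context {R : realType} {d : nat} (Omega : set 'rV[R]_d).
Hypothesis Omega_open : open Omega.
Implicit Types (n : nat) (x : 'rV[R]_d).

Lemma C1_comb n (a : 'I_n -> R) (f : 'I_n -> 'rV[R]_d -> R) :
  (forall j, C1 Omega (f j)) -> C1 Omega (fun y => \sum_j a j * f j y).
Proof.
move=> C1f; elim: (index_enum _) => [|j r IH].
  by under eq_fun do rewrite big_nil; exact: C1_cst.
under eq_fun do rewrite big_cons.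
have C1a := C1M Omega_open (C1_cst (a j)) (C1f j).
exact: (C1D Omega_open C1a IH).
Qed.

(** Both claims are proved in one induction: splitting the trace of a sum requires that the tail
    already extends continuously. *)
Lemma C0bar_trace_comb n (a : 'I_n -> R) (f : 'I_n -> 'rV[R]_d -> R) :
  (forall j, C0bar Omega (f j)) -> C0bar Omega (fun y => \sum_j a j * f j y) /\
  forall x, closure Omega x ->
    trace Omega (fun y => \sum_j a j * f j y) x =
    \sum_j a j * trace Omega (f j) x.
Proof.
move=> C0f; elim: (index_enum _) => [|j r [IH tr]].
  under eq_fun do rewrite big_nil; split; first exact: C0bar_cst.
  by move=> x cx; rewrite big_nil trace_cst.
under eq_fun do rewrite big_cons.
have C0af : C0bar Omega (fun y => a j * f j y).
  by apply: C0barM => //; exact: C0bar_cst.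
split; first exact: C0barD.
move=> x cx; rewrite big_cons traceD// tr// traceM ?trace_cst//.
exact: C0bar_cst.
Qed.

Lemma partial_comb n (a : 'I_n -> R) (f : 'I_n -> 'rV[R]_d -> R) i x :
  (forall j, differentiable (f j) x) ->
  partial i (fun y => \sum_j a j * f j y) x = \sum_j a j * partial i (f j) x.
Proof.
move=> df; rewrite partial_sum => [|j]; last exact: differentiableZ.
by apply: eq_bigr => j _; rewrite partialZ.
Qed.

Lemma C1bar_comb n (a : 'I_n -> R) (f : 'I_n -> 'rV[R]_d -> R) :
  (forall j, C1bar Omega (f j)) -> C1bar Omega (fun y => \sum_j a j * f j y).
Proof.
move=> C1f; split; first by apply: C1_comb => j; case: (C1f j).
- by apply: (C0bar_trace_comb _ _).1 => j; case: (C1f j).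
- move=> i.
  apply: (@C0bar_eq _ _ _ _ (fun y => \sum_j a j * partial i (f j) y)).
    move=> y Oy; rewrite partial_comb// => j.
    by have [C1fj _ _] := C1f j; exact: C1_differentiable Oy.
  by apply: (C0bar_trace_comb _ _).1 => j; case: (C1f j).
Qed.

Lemma C1bar_coord n (f : 'rV[R]_d -> 'rV[R]_n) c :
  C1bar Omega f -> C1bar Omega (fun y => f y 0 c).
Proof.
move=> [C1f C0f C0p]; split; [exact: C1_coord|exact: C0bar_coord|move=> i].
apply: (@C0bar_eq _ _ _ _ (fun y => partial i f y 0 c)).
  by move=> y Oy; rewrite partial_coord//; exact: C1_differentiable Oy.
exact: C0bar_coord.
Qed.

End Combination.

(** * Borel measurability and integrability on the domain *)

Section Measurability.
Context {R : realType} {d : nat}.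
Implicit Types (D : set 'rV[R]_d) (f : 'rV[R]_d -> R).

Lemma open_measurable_borel D : open D -> measurable (D : set (borel_rV R d)).
Proof. by move=> Dopen; exact: sub_sigma_algebra. Qed.

Lemma closed_measurable_borel D :
  closed D -> measurable (D : set (borel_rV R d)).
Proof.
move=> /closed_openC/open_measurable_borel mD.
by rewrite -(setCK D); exact: measurableC.
Qed.

Lemma continuous_measurable_borel D f : measurable (D : set (borel_rV R d)) ->
  {within D, continuous f} -> measurable_fun (D : set (borel_rV R d)) f.
Proof.
move=> mD /continuousP cf; apply: (measurability _ (RGenOpens.measurableE R)).
move=> _ [_ [a [b ->] <-]].
have /cf/open_subspaceP[V oV VD] : open `]a, b[%classic by exact: interval_open.
by rewrite setIC -VD; apply: measurableI => //; exact: open_measurable_borel.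
Qed.

Variable Omega : set 'rV[R]_d.

Lemma trace_measurable f : C0bar Omega f ->
  measurable_fun (closure Omega : set (borel_rV R d)) (trace Omega f).
Proof.
move=> C0f; apply: continuous_measurable_borel; last exact: trace_continuous.
exact: (closed_measurable_borel (@closed_closure _ _)).
Qed.

Lemma bdry_measurable : measurable (bdry Omega : set (borel_rV R d)).
Proof.
apply: measurableD; last exact: (open_measurable_borel (@open_interior _ _)).
exact: (closed_measurable_borel (@closed_closure _ _)).
Qed.

Lemma C0bar_measurable f : open Omega -> C0bar Omega f ->
  measurable_fun (Omega : set (borel_rV R d)) f.
Proof.
move=> Oopen C0f.
apply: (@eq_measurable_fun _ _ (borel_rV R d) _ Omega (trace Omega f)).
  by move=> x; rewrite inE => /(trace_id C0f).
apply: measurable_funS (trace_measurable C0f).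
  exact: (closed_measurable_borel (@closed_closure _ _)).
exact: subset_closure.
Qed.

Hypothesis Omega_bounded : bounded_set Omega.

Lemma closure_compact : compact (closure Omega).
Proof.
apply: bounded_closed_compact; last exact: closed_closure.
have [M [Mreal OM]] := Omega_bounded; exists M; split => // N /OM ON x cx.
have : closed [set y : 'rV[R]_d | `|y| <= N].
  by apply: (preimage_closed _ (@closed_le _ N)) => y _; exact: norm_continuous.
by apply; apply: closureS cx.
Qed.

(** The trace is continuous on the compact closure and agrees with [f] on [Omega]. *)
Lemma C0bar_bounded f : C0bar Omega f -> [bounded f x | x in Omega].
Proof.
move=> C0f.
have := continuous_compact (trace_continuous C0f) closure_compact.
move=> /compact_bounded[M [Mreal fM]]; exists M; split=> // N /fM fN x Ox.
rewrite /= -(trace_id C0f Ox); apply: fN; exists x => //.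
exact: subset_closure.
Qed.

Variable mu : {measure set (borel_rV R d) -> \bar R}.
Hypothesis mu_lebesgue : is_lebesgue mu.
Hypothesis Omega_open : open Omega.

Lemma bounded_finite_measure : (mu Omega < +oo)%E.
Proof.
have [M [Mreal OM]] := Omega_bounded.
(* The bound on [Omega] holds for every number above [M], and [M] itself may be negative; this [N]
   exceeds [M] and is nonnegative. *)
pose N := `|M| + 1.
have MN : M < N by rewrite (le_lt_trans (ler_norm _))// ltrDl.
have N0 : 0 <= N by rewrite addr_ge0.
(* The boxes measured by [is_lebesgue] are open on the left, so the lower corner lies strictly below
   [- N]. *)
pose lo : 'rV[R]_d := const_mx (- (N + 1)); pose hi : 'rV[R]_d := const_mx N.
pose box := [set x : 'rV[R]_d | forall i, lo 0 i < x 0 i <= hi 0 i].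
have mbox : measurable (box : set (borel_rV R d)).
  have -> : box = \bigcap_(i in [set: 'I_d])
      ((fun x : 'rV[R]_d => x 0 i) @^-1` `]- (N + 1), N]%classic).
    apply/seteqP; split=> x /= bx i.
      by move=> _; rewrite /= in_itv/=; have := bx i; rewrite !mxE.
    by have := bx i I; rewrite /= in_itv/= !mxE.
  apply: fin_bigcap_measurable => // i _.
  rewrite -[X in measurable X]setTI; apply: continuous_measurable_borel => //.
  by apply: continuous_subspaceT => x; exact: coord_continuous.
apply: (@le_lt_trans _ _ (mu box)).
  apply: le_measure; rewrite ?inE//; first exact: open_measurable_borel.
  move=> x Ox i; rewrite !mxE.
  have : `|x 0 i| <= N.
    apply: le_trans (OM _ MN _ Ox).
    rewrite [leRHS]/Num.Def.normr/= mx_normrE; apply/bigmax_geP; right => /=.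
    by exists (0, i).
  rewrite ler_norml => /andP[xN ->].
  by rewrite andbT (lt_le_trans _ xN)// ltrN2 ltrDl.
rewrite /box mu_lebesgue ?ltry// => i.
by rewrite !mxE (le_trans _ N0)// oppr_le0 addr_ge0.
Qed.

Lemma C0bar_integrable f : C0bar Omega f ->
  mu.-integrable Omega (EFin \o f).
Proof.
move=> C0f; apply: measurable_bounded_integrable.
- exact: open_measurable_borel.
- exact: bounded_finite_measure.
- exact: C0bar_measurable.
- exact: C0bar_bounded.
Qed.

End Measurability.

(** * Normalization and integration by parts *)

(* Unlike [ge0_le_integral], no measurability is assumed. *)
Lemma ge0_le_nnintegral {dT} {T : measurableType dT} {R : realType}
    (mu : {measure set T -> \bar R}) (D : set T) (f g : T -> \bar R) :
  (forall x, D x -> 0 <= f x)%E -> (forall x, D x -> f x <= g x)%E ->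
  (\int[mu]_(x in D) f x <= \int[mu]_(x in D) g x)%E.
Proof.
move=> f0 fg; have g0 x : D x -> (0 <= g x)%E.
  by move=> Dx; apply: le_trans (f0 x Dx) (fg x Dx).
rewrite !ge0_integralE//; apply: ereal_sup_le => _ [h hf <-]; exists h => // x.
by apply: le_trans (hf x) _; apply: lee_restrict.
Qed.

Lemma energy_eq {R : realType} {d : nat}
    (mu : {measure set (borel_rV R d) -> \bar R}) (Omega : set 'rV[R]_d)
    (f g : 'rV[R]_d -> 'rV[R]_3) : open Omega ->
  (forall x, Omega x -> f x = g x) -> energy mu Omega f = energy mu Omega g.
Proof.
move=> Oopen fg; apply: eq_integral => x; rewrite inE => Ox.
apply: (congr1 (fun z => (2^-1 * z)%:E)); apply: eq_bigr => i _.
by rewrite (partial_eq Oopen i fg Ox).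
Qed.

(** * Normalization to unit length *)

Section Normalization.
Context {R : realType} {d n : nat}.
Implicit Types (M : 'rV[R]_d -> 'rV[R]_n) (x : 'rV[R]_d).

Definition normalize M x := (elen (M x))^-1 *: M x.

Lemma elen_gt0 (v : 'rV[R]_n) : v != 0 -> 0 < elen v.
Proof. by move=> /dot_gt0; rewrite sqrtr_gt0. Qed.

Lemma elen_normalize M x : M x != 0 -> elen (normalize M x) = 1.
Proof.
move=> /elen_gt0 M0; apply/eqP; rewrite -(@eqrXn2 _ 2)// ?sqrtr_ge0// expr1n.
rewrite sqr_elen /normalize dotZr dotC dotZr -sqr_elen.
by rewrite expr2 mulKf ?mulVf// gt_eqF.
Qed.

Lemma partial_row i M c x : (forall c, differentiable (fun y => M y 0 c) x) ->
  partial i M x 0 c = partial i (fun y => M y 0 c) x.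
Proof.
move=> dM; rewrite /partial derive_mx ?mxE//; apply/derivable_mxP => a e.
by rewrite (ord1 a); exact: diff_derivable.
Qed.

(** Differentiating [M / |M|] removes from the derivative of [M] its component along [M] and divides
    the rest by [|M|]; with [|M| >= 1] neither operation increases the length. *)
Lemma elen_partial_normalize M i x :
  (forall c, differentiable (fun y => M y 0 c) x) -> 1 <= dot (M x) (M x) ->
  elen (partial i (normalize M) x) ^+ 2 <= elen (partial i M x) ^+ 2.
Proof.
move=> dMc M1; have q0 : 0 < dot (M x) (M x) by apply: lt_le_trans M1.
pose q y := dot (M y) (M y); pose r y := elen (M y).
have dq : differentiable q x.
  by apply: differentiable_fsum => c; exact: differentiableM.
have dr : differentiable r x.
  apply: (@differentiable_comp _ _ _ _ q Num.sqrt) => //.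
  by apply/derivable1_diffP; have [] := is_derive1_sqrt q0.
have r0 : 0 < r x by rewrite sqrtr_gt0.
have dN c : differentiable (fun y => normalize M y 0 c) x.
  rewrite (_ : (fun _ => _) = fun y => (r y)^-1 * M y 0 c); last first.
    by apply/funext => y; rewrite mxE.
  by apply: differentiableM => //; apply: differentiableV => //; rewrite gt_eqF.
pose p c := partial i (fun y => M y 0 c) x.
pose S := \sum_c M x 0 c * p c.
(* Obtained by differentiating [r^2 = q]. *)
have rr : r x * partial i r x = S.
  have : partial i q x = r x * partial i r x + r x * partial i r x.
    rewrite -partialM//; congr partial; apply/funext => y.
    by rewrite -expr2 sqr_elen.
  rewrite partial_sum; last by move=> c; exact: differentiableM.
  under eq_bigr do rewrite partialM//.
  by rewrite big_split/= -/S; lra.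
have Nc c : partial i (normalize M) x 0 c = (p c - M x 0 c * S / q x) / r x.
  rewrite partial_row//.
  (* The product rule for [M = r * normalize M] is solved for the derivative of the second factor.
     This factorization also holds where [M] vanishes, both sides being 0. *)
  have rN : p c = r x * partial i (fun y => normalize M y 0 c) x +
      normalize M x 0 c * partial i r x.
    rewrite -partialM//; congr partial; apply/funext => y; rewrite mxE.
    have [->|/elen_gt0 My0] := eqVneq (M y) 0; first by rewrite mxE !mulr0.
    by rewrite mulrA divff ?mul1r// gt_eqF.
  have qE : q x = r x ^+ 2 by rewrite sqr_elen.
  rewrite rN mxE -/(r x) -rr qE; field.
  by rewrite gt_eqF.
have pM c : p c = partial i M x 0 c by rewrite partial_row.
rewrite (sqr_elenE (partial i (normalize M) x)) (sqr_elenE (partial i M x)).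
under eq_bigr do rewrite Nc.
under [leRHS]eq_bigr do rewrite -pM.
have qS : \sum_c M x 0 c ^+ 2 = q x by rewrite -dotE2.
(* Pythagoras: [S^2 / q] is the squared length of the component of [p] along [M]. *)
have -> : \sum_c ((p c - M x 0 c * S / q x) / r x) ^+ 2 =
    (\sum_c p c ^+ 2 - S ^+ 2 / q x) / q x.
  have -> : \sum_c ((p c - M x 0 c * S / q x) / r x) ^+ 2 =
    \sum_c (p c ^+ 2 / q x - 2 * S / q x ^+ 2 * (M x 0 c * p c) +
              S ^+ 2 / q x ^+ 3 * M x 0 c ^+ 2).
    apply: eq_bigr => c _; have qE : q x = r x ^+ 2 by rewrite sqr_elen.
    by rewrite qE; field; rewrite gt_eqF.
  rewrite big_split/= sumrB -mulr_suml -!mulr_sumr qS -/S.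
  by field; rewrite gt_eqF.
have p0 : 0 <= \sum_c p c ^+ 2 by apply: sumr_ge0 => c _; exact: sqr_ge0.
rewrite ler_pdivrMr//; apply: (@le_trans _ _ (\sum_c p c ^+ 2)).
  by rewrite gerBl mulr_ge0 ?sqr_ge0// invr_ge0 ltW.
by rewrite ler_peMr.
Qed.

End Normalization.

(** * Green's first identity *)

Section Green.
Context {R : realType} {d : nat}.
Variables (mu sigma : {measure set (borel_rV R d) -> \bar R}).
Variables (Omega : set 'rV[R]_d) (nu : 'rV[R]_d -> 'rV[R]_d).
Hypothesis mu_lebesgue : is_lebesgue mu.
Hypothesis Omega_regular : regular_domain mu sigma Omega nu.
Implicit Types (f g : 'rV[R]_d -> R) (x : 'rV[R]_d).

Definition green_field f g (i : 'I_d) := fun y => partial i f y * g y.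

Lemma divergence_green f g x :
  (forall i, differentiable (partial i f) x) -> differentiable g x ->
  divergence (green_field f g) x =
  laplacian f x * g x + \sum_i partial i f x * partial i g x.
Proof.
move=> df dg; rewrite mulr_suml -big_split; apply: eq_bigr => i _ /=.
by rewrite /green_field partialM// addrC [g x * _]mulrC.
Qed.

Variables f g : 'rV[R]_d -> R.
Hypotheses (f_C1bar : C1bar Omega f) (f_C2 : forall i, C1 Omega (partial i f)).
Hypothesis f_laplacian : mu.-integrable Omega (EFin \o laplacian f).
Hypothesis g_C1bar : C1bar Omega g.

(** The Laplacian of [f] is merely integrable, but it is multiplied by the bounded [g]; the gradient
    products extend continuously to the closure. *)
Lemma green_integrable :
  mu.-integrable Omega (EFin \o divergence (green_field f g)).
Proof.
have Oopen := domain_open Omega_regular.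
have Obnd := domain_bounded Omega_regular.
have mO := open_measurable_borel Oopen.
have [C1g C0g C0pg] := g_C1bar; have [C1f C0f C0pf] := f_C1bar.
have fg : mu.-integrable Omega (EFin \o (fun x => laplacian f x * g x)).
  apply: (@eq_integrable _ _ _ _ _ mO ((EFin \o laplacian f) \* (EFin \o g))%E).
    by move=> x _ /=; rewrite EFinM.
  apply: integrableMl => //; first exact: C0bar_measurable.
  exact: C0bar_bounded.
have fg' : mu.-integrable Omega
    (EFin \o (fun x => \sum_i 1 * (partial i f x * partial i g x))).
  apply: C0bar_integrable => //.
  apply: (C0bar_trace_comb _ _).1 => i; exact: C0barM.
apply: eq_integrable (integrableD mO fg fg') => //.
move=> x; rewrite inE => Ox /=; rewrite -EFinD divergence_green.
- by congr ((_ + _)%:E); apply: eq_bigr => i _; rewrite mul1r.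
- by move=> i; exact: (C1_differentiable (f_C2 i) Ox).
- exact: (C1_differentiable C1g Ox).
Qed.

(** By the divergence theorem the integral is that of the flux of [g grad f], whose density is the
    product assumed to vanish almost everywhere. *)
Lemma green_integral_eq0 :
  {ae sigma, forall x, bdry Omega x ->
    (\sum_i trace Omega (partial i f) x * nu x 0 i) * trace Omega g x = 0} ->
  (\int[mu]_(x in Omega) (divergence (green_field f g) x)%:E = 0)%E.
Proof.
have Oopen := domain_open Omega_regular.
have [C1g C0g C0pg] := g_C1bar; have [C1f C0f C0pf] := f_C1bar.
move=> fg0; rewrite (divergence_theorem Omega_regular); last 2 first.
- move=> i; split; first exact: (C1M Oopen (f_C2 i) C1g).
  exact: (C0barM (C0pf i) C0g).
- exact: green_integrable.
have trF x i : bdry Omega x -> trace Omega (green_field f g i) x =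
    trace Omega (partial i f) x * trace Omega g x.
  by move=> [cx _]; exact: traceM.
have mtr (h : 'rV[R]_d -> R) : C0bar Omega h ->
    measurable_fun (bdry Omega : set (borel_rV R d)) (trace Omega h).
  move=> C0h; apply: measurable_funS (trace_measurable C0h).
    exact: (closed_measurable_borel (@closed_closure _ _)).
  exact: subDsetl.
transitivity (\int[sigma]_(x in bdry Omega) (cst 0%E x))%E;
  last exact: integral0.
apply: ae_eq_integral; first exact: bdry_measurable.
- apply/measurable_EFinP; apply: measurable_sum => i.
  apply: measurable_funM; last exact: (normal_measurable Omega_regular).
  by apply: mtr; exact: C0barM.
- exact: measurable_cst.
- apply: (@filterS _ _ (ae_filter_ringOfSetsType sigma)) fg0 => x fg0 bx.
  congr EFin; rewrite -[RHS](fg0 bx) mulr_suml.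
  by apply: eq_bigr => i _; rewrite trF// mulrAC.
Qed.

End Green.

(** * The scheme *)

Section Coefficients.
Context {R : realType} {s : nat}.
Variables (tau : R) (A D : 'M[R]_s) (b : 'cV[R]_s).

(* [slope_of y] recovers [k] from [y_l = y_0 + tau sum_j a_lj k_j]; the slopes
   thereby inherit the regularity of the stages, although they are
   defined through second derivatives. *)
Definition slope_coef (j : 'I_s) (l : 'I_s.+1) : R :=
  if unlift ord0 l is Some l' then tau^-1 * invmx A j l'
  else - \sum_l' tau^-1 * invmx A j l'.

Definition slope_of (y : 'I_s.+1 -> R) : 'cV[R]_s :=
  \col_j \sum_l slope_coef j l * y l.

(** Weights of the stages in [u_0 + tau sum_j b_j K_j] once each slope is expressed through the
    stages. *)
Definition update_coef (l : 'I_s.+1) : R :=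
  (l == ord0)%:R + tau * \sum_j b j 0 * slope_coef j l.

Lemma slope_ofE y :
  slope_of y = tau^-1 *: (invmx A *m \col_l (y (lift ord0 l) - y ord0)).
Proof.
apply/colP => j; rewrite !mxE big_ord_recl /slope_coef unlift_none.
under [X in _ + X = _]eq_bigr do rewrite liftK.
rewrite mulNr mulr_suml mulr_sumr addrC -sumrB; apply: eq_bigr => l _.
by rewrite mxE; ring.
Qed.

Lemma update_coefE y :
  \sum_l update_coef l * y l = y ord0 + tau * \sum_j b j 0 * slope_of y j 0.
Proof.
under eq_bigr do rewrite mulrDl; rewrite big_split; congr (_ + _).
  rewrite (bigD1 ord0)// eqxx mul1r big1 => [|l /negbTE ->].
    exact: addr0.
  by rewrite mul0r.
under eq_bigr do rewrite -mulrA mulr_suml.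
rewrite -mulr_sumr exchange_big; congr (_ * _); apply: eq_bigr => j _.
by rewrite mxE mulr_sumr; apply: eq_bigr => l _; rewrite mulrA.
Qed.

Hypotheses (tau_neq0 : tau != 0) (A_unit : A \in unitmx).

Lemma slope_of_stage (y : 'I_s.+1 -> R) (k : 'cV[R]_s) :
  (forall l, y (lift ord0 l) = y ord0 + tau * (A *m k) l 0) -> slope_of y = k.
Proof.
move=> yk; rewrite slope_ofE.
have -> : \col_l (y (lift ord0 l) - y ord0) = tau *: (A *m k).
  by apply/colP => l; rewrite !mxE yk mxE addrC addKr.
by rewrite -scalemxAr scalerA mulVf// scale1r mulKmx.
Qed.

(** Holds for every family [y], hence also for the partial derivatives of the stages, whose slopes
    are defined by [slope_of]. *)
Lemma stage_slope_of y l :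
  y (lift ord0 l) = y ord0 + tau * (A *m slope_of y) l 0.
Proof.
rewrite slope_ofE -scalemxAr mulKVmx// !mxE mulrA divff// mul1r.
by rewrite addrC subrK.
Qed.

(** Averaging the stage relations with weights of sum 1 leaves the term [y ord0] unchanged. *)
Lemma average_slope_of y j : \sum_l D j l = 1 ->
  \sum_l D j l * y (lift ord0 l) = y ord0 + tau * (D *m A *m slope_of y) j 0.
Proof.
move=> Dj; under eq_bigr do rewrite stage_slope_of mulrDr.
rewrite big_split/= -mulr_suml Dj mul1r; congr (_ + _).
rewrite -mulmxA [X in _ = _ * X]mxE mulr_sumr.
by apply: eq_bigr => l _; rewrite mulrCA.
Qed.

Lemma update_sqr_le y : psd (Qmat A D b) -> (forall j, \sum_l D j l = 1) ->
  (\sum_l update_coef l * y l) ^+ 2 <= y ord0 ^+ 2 +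
    2 * tau * \sum_j b j 0 * (\sum_l D j l * y (lift ord0 l)) * slope_of y j 0.
Proof.
move=> Qpsd D1; rewrite update_coefE.
apply: le_trans (energy_update_le _ _ _ Qpsd) _.
by under [X in _ <= _ + _ * X]eq_bigr do rewrite average_slope_of//.
Qed.

Lemma update_sqr_ge y : psd (Rmat A b) ->
  y ord0 ^+ 2 +
    2 * tau * \sum_j b j 0 * y (widen_ord (leqnSn s) j) * slope_of y j 0 <=
  (\sum_l update_coef l * y l) ^+ 2.
Proof.
move=> Rpsd; rewrite update_coefE.
apply: le_trans (length_update_ge _ _ _ Rpsd).
suff yj j : y (widen_ord (leqnSn s) j) =
    y ord0 + tau * (subdiag R s *m A *m slope_of y) j 0.
  by under eq_bigr do rewrite yj.
(* The shift [J] has an empty first row, which leaves [y ord0]; row [j + 1] picks row [j] of [A],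
   whose relation gives stage [j + 1]. *)
rewrite -mulmxA mul_subdiag; case: j => -[|j] js /=.
  by rewrite big1 ?mulr0 ?addr0//; congr y; exact/val_inj.
rewrite (big_pred1 (Ordinal (ltnW js)))/=; last first.
  by move=> l /=; rewrite eqSS eq_sym.
by rewrite -stage_slope_of; congr y; exact/val_inj.
Qed.

End Coefficients.

(** * Length bound and energy decay for the scheme *)

Section SchemeEnergy.
Context {R : realType} {d s : nat}.
Variables (mu sigma : {measure set (borel_rV R d) -> \bar R}).
Variables (Omega : set 'rV[R]_d) (nu : 'rV[R]_d -> 'rV[R]_d).
Variables (alpha beta tau : R) (A D : 'M[R]_s) (b : 'cV[R]_s).
Variable u : nat -> 'rV[R]_d -> 'rV[R]_3.
Hypothesis mu_lebesgue : is_lebesgue mu.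
Hypothesis Omega_regular : regular_domain mu sigma Omega nu.
Hypotheses (alpha_gt0 : 0 < alpha) (tau_gt0 : 0 < tau).
Hypotheses (A_lower : is_trig_mx A) (D_lower : is_trig_mx D).
Hypothesis A_diag : forall i, 0 < A i i.
Hypothesis D_rows : forall i : 'I_s, \sum_(j < s | (j <= i)%N) D i j = 1.
Hypothesis u_unit : forall x, Omega x -> elen (u 0%N x) = 1.
Hypothesis u_stages : stage_equations alpha beta tau A D u Omega.
Hypothesis u_bc : dirichlet s Omega u \/ neumann s sigma Omega nu u.
Hypothesis u_neq0 : forall i, (i < s)%N -> forall x, Omega x -> u i x != 0.
Hypothesis u_regular : regular_stages s mu Omega u.
Hypothesis b_ge0 : forall i, 0 <= b i 0.
Hypotheses (Q_psd : psd (Qmat A D b)) (R_psd : psd (Rmat A b)).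
Implicit Types (x : 'rV[R]_d) (c : 'I_3) (j : 'I_s).

Let A_unit : A \in unitmx. Proof. exact: trig_unitmx. Qed.
Let tau_neq0 : tau != 0. Proof. by rewrite gt_eqF. Qed.
Let Omega_open : open Omega := domain_open Omega_regular.

Let D_sum j : \sum_l D j l = 1.
Proof.
rewrite (bigID (fun l : 'I_s => l <= j)%N)/= D_rows big1 ?addr0// => l.
by rewrite -ltnNge; move/is_trig_mxP: D_lower; exact.
Qed.

Definition stage_coord c (l : nat) x := u l x 0 c.

Definition slope_field c j x :=
  \sum_l slope_coef tau A j l * stage_coord c (l : 'I_s.+1) x.

(** Replaces [mtilde], with which it agrees on [Omega], by a form without second derivatives. *)
Definition update_field x : 'rV[R]_3 :=
  \row_c \sum_l update_coef tau A b l * stage_coord c (l : 'I_s.+1) x.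

Definition average_field c j x :=
  \sum_l D j l * stage_coord c (l : 'I_s).+1 x.

Lemma stage_coord_C1bar c (l : 'I_s.+1) : C1bar Omega (stage_coord c l).
Proof.
have [C1u0 _ C1u _] := u_regular.
apply: (C1bar_coord Omega_open); case: l => -[|l] ls; first exact: C1u0.
exact: (C1u l.+1 ls).
Qed.

Lemma stage_coord_differentiable c (l : 'I_s.+1) x :
  Omega x -> differentiable (stage_coord c l) x.
Proof.
by have [C1u _ _] := stage_coord_C1bar c l; exact: C1_differentiable.
Qed.

(** The stage equations, with [A] invertible, determine the slopes. *)
Lemma slope_fieldE c j x : Omega x ->
  slope_field c j x = slope alpha beta D u j x 0 c.
Proof.
move=> Ox; have := @slope_of_stage _ _ tau A tau_neq0 A_unit
  (fun l => stage_coord c l x) (\col_j slope alpha beta D u j x 0 c).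
move=> /(_ _)/(congr1 (fun z : 'cV_s => z j 0)); rewrite !mxE; apply => l.
rewrite -trig_sum_mul// /stage_coord lift0 (u_stages l Ox) !mxE summxE.
by congr (_ + _ * _); apply: eq_bigr => i _; rewrite !mxE.
Qed.

Lemma mtildeE x : Omega x -> mtilde alpha beta tau D b u x = update_field x.
Proof.
move=> Ox; apply/rowP => c; rewrite [RHS]mxE update_coefE.
rewrite !mxE summxE; congr (_ + _ * _); apply: eq_bigr => j _.
by rewrite mxE -slope_fieldE// mxE.
Qed.

Lemma update_length_ge1 x :
  Omega x -> 1 <= dot (update_field x) (update_field x).
Proof.
move=> Ox; rewrite dotE2.
have orth j : dot (u j x) (slope alpha beta D u j x) = 0.
  by apply: dot_Pop_eq0; exact: u_neq0.
(* The squares sum to [|u_0|^2 = 1], and the mixed terms to multiples of [u_j . K_j = 0]; the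
   coordinatewise lower bound then applies to each summand. *)
have -> : 1 = \sum_c (stage_coord c 0%N x ^+ 2 + 2 * tau *
    \sum_j b j 0 * stage_coord c j x * slope_field c j x).
  rewrite big_split/= -dotE2 -sqr_elen u_unit// expr1n -mulr_sumr.
  rewrite exchange_big big1 ?mulr0 ?addr0//= => j _.
  under eq_bigr do rewrite -mulrA slope_fieldE//.
  by rewrite -mulr_sumr [X in _ * X](orth j) mulr0.
apply: ler_sum => c _; rewrite mxE.
apply: le_trans (update_sqr_ge tau_neq0 A_unit _ R_psd).
by under [X in _ <= _ + _ * X]eq_bigr do rewrite [X in _ * X]mxE.
Qed.

Lemma update_neq0 x : Omega x -> update_field x != 0.
Proof.
move=> /update_length_ge1 M1; apply: contraTneq M1 => ->.
by rewrite -ltNge /dot big1 ?ltr01// => c _; rewrite mxE mul0r.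
Qed.


Lemma update_coordE c : (fun y => update_field y 0 c) =
  (fun y => \sum_l update_coef tau A b l * stage_coord c (l : 'I_s.+1) y).
Proof. by apply/funext => y; rewrite mxE. Qed.

Lemma update_coord_C1bar c : C1bar Omega (fun y => update_field y 0 c).
Proof.
rewrite update_coordE.
by apply: C1bar_comb => // l; exact: stage_coord_C1bar.
Qed.

Lemma slope_field_C1bar c j : C1bar Omega (slope_field c j).
Proof. by apply: C1bar_comb => // l; exact: stage_coord_C1bar. Qed.

Lemma average_field_C1bar c j : C1bar Omega (average_field c j).
Proof.
apply: C1bar_comb => // l.
by have := stage_coord_C1bar c (lift ord0 l); rewrite lift0.
Qed.

Let stage_index (l : 'I_s) : (1 <= l.+1 <= s)%N. Proof. exact: ltn_ord. Qed.

Lemma stage_C2_coord c (l : 'I_s) i :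
  C1 Omega (fun y => partial i (u l.+1) y 0 c).
Proof.
have [_ C1p] := stage_C2 u_regular (stage_index l).
exact: (C1_coord Omega_open c (C1p i)).
Qed.

Lemma stage_partial (l : 'I_s) i c x : Omega x ->
  partial i (stage_coord c l.+1) x = partial i (u l.+1) x 0 c.
Proof.
move=> Ox; have [C1u _] := stage_C2 u_regular (stage_index l).
exact: partial_coord (C1_differentiable C1u Ox).
Qed.

Lemma average_partial c j i x : Omega x ->
  partial i (average_field c j) x = \sum_l D j l * partial i (u l.+1) x 0 c.
Proof.
move=> Ox; rewrite partial_comb => [|l].
  by apply: eq_bigr => l _; rewrite stage_partial.
by have := stage_coord_differentiable c (lift ord0 l) Ox; rewrite lift0.
Qed.

Lemma average_C2 c j i : C1 Omega (partial i (average_field c j)).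
Proof.
apply: (@C1_eq _ _ _ Omega_open
    (fun y => \sum_l D j l * partial i (u l.+1) y 0 c)).
  by move=> y Oy; rewrite average_partial.
by apply: C1_comb => // l; exact: stage_C2_coord.
Qed.

Lemma average_laplacian c j x : Omega x ->
  laplacian (average_field c j) x = \sum_l D j l * laplacian (u l.+1) x 0 c.
Proof.
move=> Ox; rewrite /laplacian.
transitivity (\sum_i \sum_l D j l * partial i (partial i (u l.+1)) x 0 c).
  apply: eq_bigr => i _.
  have avg y := average_partial c j i (x := y).
  rewrite (partial_eq Omega_open _ avg Ox).
  rewrite partial_comb => [|l].
    apply: eq_bigr => l _; rewrite partial_coord//.
    have [_ /(_ i) C1p] := stage_C2 u_regular (stage_index l).
    exact: C1_differentiable Ox.
  exact: C1_differentiable (stage_C2_coord c l i) Ox.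
rewrite exchange_big; apply: eq_bigr => l _.
by rewrite summxE mulr_sumr.
Qed.

Lemma average_laplacian_integrable c j :
  mu.-integrable Omega (EFin \o laplacian (average_field c j)).
Proof.
have mO := open_measurable_borel Omega_open.
apply: (@eq_integrable _ _ _ _ _ mO
    (fun x => \sum_l (D j l)%:E * (laplacian (u l.+1) x 0 c)%:E)%E).
  move=> x; rewrite inE => Ox /=; rewrite average_laplacian// -sumEFin.
  by apply: eq_bigr => l _; rewrite EFinM.
apply: integrable_sum => // l _; apply: integrableZl => //.
exact: (stage_laplacian u_regular (stage_index l) c).
Qed.

(** The Laplacian of the average is exactly the vector [w] to which slope [j] applies [P(u_j)], so
    the sum is [w . P(u_j) w]. *)
Lemma dissipation_ge0 j x : Omega x ->
  0 <= \sum_c laplacian (average_field c j) x * slope_field c j x.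
Proof.
move=> Ox; set w := \sum_(l < s | (l <= j)%N) D j l *: laplacian (u l.+1) x.
have -> : \sum_c laplacian (average_field c j) x * slope_field c j x =
    dot w (Pop alpha beta (u j x) w).
  apply: eq_bigr => c _; rewrite slope_fieldE// average_laplacian//.
  congr (_ * _); rewrite summxE (bigID (fun l : 'I_s => l <= j)%N)/=.
  rewrite [X in _ + X]big1 ?addr0.
    by apply: eq_bigr => l _; rewrite mxE.
  move=> l; rewrite -ltnNge => jl.
  by move/is_trig_mxP : D_lower => /(_ _ _ jl) ->; rewrite mul0r.
by apply: dot_Pop_ge0; [exact: ltW|exact: u_neq0].
Qed.

Lemma boundary_term c j : {ae sigma, forall x, bdry Omega x ->
  (\sum_i trace Omega (partial i (average_field c j)) x * nu x 0 i) *
  trace Omega (slope_field c j) x = 0}.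
Proof.
have C0u (l : 'I_s.+1) : C0bar Omega (stage_coord c l).
  by have [] := stage_coord_C1bar c l.
case: u_bc => [uD|uN].
  apply: aeW => x bx; have [cx _] := bx.
  rewrite [X in _ * X](C0bar_trace_comb _ C0u).2//.
  have u0 (l : 'I_s) : trace Omega (stage_coord c (lift ord0 l)) x =
      trace Omega (stage_coord c 0%N) x.
    have [_ C0u0 _] := initial_regular u_regular.
    have [_ C0ul _] := stage_C1bar u_regular (stage_index l).
    by rewrite lift0 !trace_coord// uD// ltn_ord.
  (* Dirichlet case: all stages have the same trace at [x], so the traces satisfy the stage
     relations with zero slopes. *)
  have := @slope_of_stage _ _ tau A tau_neq0 A_unit
    (fun l => trace Omega (stage_coord c l) x) 0.
  move=> /(_ _)/(congr1 (fun z : 'cV_s => z j 0)); rewrite !mxE => ->.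
    by rewrite mulr0.
  by move=> l; rewrite mulmx0 mxE mulr0 addr0 u0.
(* Neumann case: the finitely many exceptional null sets, one per stage, are merged. *)
have := @filter_forall _ _ _ _ (ae_filter_ringOfSetsType sigma)
  (fun l : 'I_s => uN l.+1 (stage_index l)).
apply: (@filterS _ _ (ae_filter_ringOfSetsType sigma)) => x uN0 bx.
have [cx _] := bx.
suff -> : \sum_i trace Omega (partial i (average_field c j)) x * nu x 0 i = 0.
  by rewrite mul0r.
have C0pu i (l : 'I_s) : C0bar Omega (partial i (u l.+1)).
  by have [] := stage_C1bar u_regular (stage_index l).
transitivity (\sum_l D j l * normal_derivative Omega nu (u l.+1) x 0 c).
  rewrite /normal_derivative.
  under [RHS]eq_bigr do rewrite summxE mulr_sumr.
  rewrite [RHS]exchange_big; apply: eq_bigr => i _.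
  rewrite (trace_eq _ (fun y => average_partial c j i (x := y))).
  rewrite (C0bar_trace_comb _ (fun l => C0bar_coord c (C0pu i l))).2//.
  rewrite mulr_suml; apply: eq_bigr => l _.
  by rewrite trace_coord// mxE -mulrA [X in _ * X]mulrC.
by rewrite big1// => l _; rewrite uN0// mxE mulr0.
Qed.

(** Pointwise form of the energy law: the excess over the initial density is at most a sum of
    divergences, each of which integrates to zero. *)
Lemma energy_density_le x : Omega x ->
  2^-1 * \sum_i elen (partial i update_field x) ^+ 2 <=
  2^-1 * (\sum_i elen (partial i (u 0%N) x) ^+ 2) +
  \sum_j \sum_c tau * b j 0 *
    divergence (green_field (average_field c j) (slope_field c j)) x.
Proof.
move=> Ox; have [C1u0 _ _] := initial_regular u_regular.
have dM c : differentiable (fun y => update_field y 0 c) x.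
  by have [C1M _ _] := update_coord_C1bar c; exact: C1_differentiable Ox.
pose G c j :=
  \sum_i partial i (average_field c j) x * partial i (slope_field c j) x.
(* The update bound from [Q] is applied to the scalar family of partial derivatives of the
   stages. *)
have coordwise i c : partial i update_field x 0 c ^+ 2 <=
    partial i (u 0%N) x 0 c ^+ 2 + 2 * tau * \sum_j b j 0 *
      (partial i (average_field c j) x * partial i (slope_field c j) x).
  have := update_sqr_le tau_neq0 A_unit
    (fun l : 'I_s.+1 => partial i (stage_coord c l) x) Q_psd D_sum.
  have dl (l : 'I_s.+1) := stage_coord_differentiable c l Ox.
  rewrite -partial_comb => [|l]; last exact: dl.
  have -> : partial i update_field x 0 c =
      partial i (fun y => \sum_l update_coef tau A b l * stage_coord c l y) x.
    by rewrite (partial_row i c dM) update_coordE.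
  move=> /le_trans; apply; rewrite -(partial_coord i c) ?lerD2l; last first.
    exact: C1_differentiable Ox.
  rewrite le_eqVlt; apply/orP/or_introl/eqP; congr (_ * _).
  apply: eq_bigr => j _; rewrite -mulrA mxE.
  by rewrite -partial_comb// -partial_comb.
have gradient : \sum_i elen (partial i update_field x) ^+ 2 <=
    \sum_i elen (partial i (u 0%N) x) ^+ 2 +
    2 * tau * \sum_j b j 0 * \sum_c G c j.
  have -> : \sum_j b j 0 * \sum_c G c j = \sum_i \sum_c \sum_j b j 0 *
      (partial i (average_field c j) x * partial i (slope_field c j) x).
    rewrite exchange_big/=; under [RHS]eq_bigr do rewrite exchange_big/=.
    rewrite [RHS]exchange_big/=; apply: eq_bigr => j _.
    rewrite mulr_sumr; apply: eq_bigr => c _.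
    by rewrite mulr_sumr.
  rewrite mulr_sumr -big_split; apply: ler_sum => i _.
  rewrite (sqr_elenE (partial i update_field x)).
  rewrite (sqr_elenE (partial i (u 0%N) x)) mulr_sumr -big_split.
  by apply: ler_sum => c _; exact: coordwise.
(* The divergence exceeds the gradient product by the nonnegative dissipation; nonnegativity of
   [tau * b j 0] later preserves this inequality under weighting. *)
have green j : \sum_c G c j <= \sum_c
    divergence (green_field (average_field c j) (slope_field c j)) x.
  have divE c :
      divergence (green_field (average_field c j) (slope_field c j)) x =
      laplacian (average_field c j) x * slope_field c j x + G c j.
    apply: divergence_green => [i|].
      exact: C1_differentiable (average_C2 c j i) Ox.
    by have [C1k _ _] := slope_field_C1bar c j; exact: C1_differentiable Ox.
  under [leRHS]eq_bigr do rewrite divE.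
  by rewrite big_split/= lerDr dissipation_ge0.
have {gradient} := ler_wpM2l (_ : 0 <= 2^-1) gradient.
move=> /(_ _)/le_trans; apply; first by rewrite invr_ge0.
rewrite mulrDr lerD2l -!mulrA mulKf ?pnatr_eq0// mulr_sumr.
apply: ler_sum => j _; rewrite -mulr_sumr mulrA ler_wpM2l//.
by rewrite mulr_ge0// ltW.
Qed.

Lemma energy_density_integrable (f : 'rV[R]_d -> 'rV[R]_3) : C1bar Omega f ->
  mu.-integrable Omega
    (EFin \o (fun x => 2^-1 * \sum_i elen (partial i f x) ^+ 2)).
Proof.
move=> [C1f C0f C0pf]; apply: C0bar_integrable => //.
  exact: domain_bounded Omega_regular.
apply: C0barM; first exact: C0bar_cst.
rewrite (_ : (fun _ => _) = fun y =>
    \sum_i 1 * \sum_c 1 * (partial i f y 0 c * partial i f y 0 c)).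
  apply: (C0bar_trace_comb _ _).1 => i; apply: (C0bar_trace_comb _ _).1 => c.
  by apply: C0barM; exact: C0bar_coord.
apply/funext => y; apply: eq_bigr => i _; rewrite mul1r sqr_elenE.
by apply: eq_bigr => c _; rewrite mul1r expr2.
Qed.

Lemma energy_update_field_le :
  (energy mu Omega (normalize update_field) <= energy mu Omega (u 0%N))%E.
Proof.
have mO := open_measurable_borel Omega_open.
pose F j c := divergence (green_field (average_field c j) (slope_field c j)).
have Fint j c : mu.-integrable Omega (fun x => (F j c x)%:E).
  apply: (green_integrable mu_lebesgue Omega_regular).
  - exact: average_field_C1bar.
  - exact: average_C2.
  - exact: average_laplacian_integrable.
  - exact: slope_field_C1bar.
(* [H] has zero integral; added to the initial energy, it reduces the comparison of energies to a
   pointwise one. *)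
pose H x := (\sum_j \sum_c (tau * b j 0)%:E * (F j c x)%:E)%E.
have Hint : mu.-integrable Omega H.
  apply: integrable_sum => // j _; apply: integrable_sum => // c _.
  exact: integrableZl.
have H0 : (\int[mu]_(x in Omega) H x = 0)%E.
  rewrite integral_sum// => [|j]; last first.
    by apply: integrable_sum => // c _; exact: integrableZl.
  rewrite big1// => j _.
  rewrite integral_sum// => [|c]; last exact: integrableZl.
  rewrite big1// => c _; rewrite integralZl//.
  rewrite (green_integral_eq0 mu_lebesgue Omega_regular) ?mule0//.
  - exact: average_field_C1bar.
  - exact: average_C2.
  - exact: average_laplacian_integrable.
  - exact: slope_field_C1bar.
  - exact: boundary_term.
have E0 := energy_density_integrable (initial_regular u_regular).
rewrite /energy -[leRHS]adde0 -H0 -integralD//.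
apply: ge0_le_nnintegral => x Ox.
  by rewrite lee_fin mulr_ge0// sumr_ge0// => i _; exact: sqr_ge0.
have dM c : differentiable (fun y => update_field y 0 c) x.
  by have [C1M _ _] := update_coord_C1bar c; exact: C1_differentiable Ox.
have -> : H x = (\sum_j \sum_c tau * b j 0 * F j c x)%:E.
  by rewrite /H -sumEFin; apply: eq_bigr => j _; rewrite -sumEFin.
(* It remains to pass from the normalized field to the update itself, which uses that its length is
   at least 1. *)
rewrite -EFinD lee_fin; apply: le_trans (energy_density_le Ox).
apply: ler_wpM2l; first by rewrite invr_ge0.
apply: ler_sum => i _; exact: elen_partial_normalize (update_length_ge1 Ox).
Qed.

End SchemeEnergy.

Unset Implicit Arguments.

Theorem theorem3p2 (R : realType) (d s : nat)
  (mu sigma : {measure set (borel_rV R d) -> \bar R})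
  (Omega : set 'rV[R]_d) (nu : 'rV[R]_d -> 'rV[R]_d)
  (alpha beta tau : R) (A D : 'M[R]_s) (b : 'cV[R]_s)
  (m : 'rV[R]_d -> 'rV[R]_3) (u : nat -> 'rV[R]_d -> 'rV[R]_3)
  (d_gt0 : (0 < d)%N)
  (mu_lebesgue : is_lebesgue mu)
  (Omega_regular : regular_domain mu sigma Omega nu)
  (alpha_gt0 : 0 < alpha) (tau_gt0 : 0 < tau)
  (A_lower : is_trig_mx A) (D_lower : is_trig_mx D)
  (A_diag : forall i, 0 < A i i) (D_diag : forall i, 0 < D i i)
  (D_rows : forall i : 'I_s, \sum_(j < s | (j <= i)%N) D i j = 1)
  (m_unit : forall x, Omega x -> elen (m x) = 1)
  (u_init : u 0%N = m)
  (u_stages : stage_equations alpha beta tau A D u Omega)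
  (u_bc : dirichlet s Omega u \/ neumann s sigma Omega nu u)
  (u_neq0 : forall i, (i < s)%N -> forall x, Omega x -> u i x != 0)
  (u_regular : regular_stages s mu Omega u)
  (b_ge0 : forall i, 0 <= b i 0)
  (Q_psd : psd (Qmat A D b)) (R_psd : psd (Rmat A b)) :
  let m' := mnext alpha beta tau D b u in
  (forall x, Omega x -> elen (m' x) = 1) /\
  (energy mu Omega m' <= energy mu Omega m)%E.
Proof.
move=> m'; rewrite -u_init in m_unit *.
have Oopen := domain_open Omega_regular.
pose M := update_field tau A b u.
(* The two fields are compared on [Omega] only; since [Omega] is open, this also identifies their
   partial derivatives there. *)
have m'E x : Omega x -> m' x = normalize M x.
  move=> Ox; have mE : mtilde alpha beta tau D b u x = M x.
    exact: (mtildeE b tau_gt0 A_lower A_diag u_stages Ox).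
  by rewrite /m' /mnext mE.
split=> [x Ox|].
  rewrite m'E//; apply: elen_normalize.
  exact: (update_neq0 tau_gt0 A_lower A_diag m_unit u_stages u_neq0 R_psd Ox).
rewrite (energy_eq mu Oopen m'E).
exact: (energy_update_field_le mu_lebesgue Omega_regular alpha_gt0 tau_gt0
  A_lower D_lower A_diag D_rows m_unit u_stages u_bc u_neq0 u_regular b_ge0
  Q_psd R_psd).
Qed.
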